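(* Let $X$ be a Hausdorff space. Then $t_s(X) \leq F(X) \cdot L(X)$.
   Context: The set-tightness $t_s(X)$ of a topological space $X$ is the minimum infinite cardinal $\kappa$ such that for every non-closed subset $A$ of $X$ and every point $p \in \overline{A} \setminus A$ there is a family $\{A_\alpha : \alpha < \kappa\}$ of subsets of $A$ such that $p \in \overline{\bigcup\{A_\alpha : \alpha < \kappa\}}$ but $p \notin \bigcup\{\overline{A_\alpha} : \alpha < \kappa\}$. A sequence $\{x_\alpha : \alpha < \kappa\}$ in $X$ is free if $\overline{\{x_\alpha : \alpha < \beta\}} \cap \overline{\{x_\alpha : \beta \leq \alpha < \kappa\}} = \emptyset$ for every $\beta < \kappa$. $F(X)$ is the supremum of the cardinalities of free sequences in $X$. The Lindelöf degree $L(X)$ is the least infinite cardinal $\kappa$ such that every open cover of $X$ has a subcover of cardinality at most $\kappa$. As is standard, all cardinal functions are taken to be infinite (so $F(X)$ means $\max\{\omega, F(X)\}$). *)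

(* Defs.v *)
From mathcomp Require Import all_boot.
From mathcomp Require Import boolp classical_sets functions cardinality wochoice.
From mathcomp Require Import topology.

Set Implicit Arguments.
Unset Strict Implicit.
Unset Printing Implicit Defensive.

Local Open Scope classical_set_scope.
Local Open Scope card_scope.

(* Cardinals are represented by types compared with [#<=]; the product of two
   cardinals is the product type.  [least_infinite_card P] is the least
   infinite cardinal satisfying [P].  It exists as soon as some infinite
   cardinal satisfies [P] (see [least_infinite_cardP]); otherwise it has the
   meaningless value [nat]. *)
Definition is_least_infinite_card (P : Type -> Prop) (K : Type) : Prop :=
  [/\ infinite_set [set: K], P K &
      forall K' : Type, infinite_set [set: K'] -> P K' ->
        [set: K] #<= [set: K']].

Definition least_infinite_card (P : Type -> Prop) : Type :=
  if pselect (exists K, is_least_infinite_card P K) is left ex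
  then sval (cid ex) else nat.

Section SetTightness.
Variable X : topologicalType.

Definition set_tightness_le (K : Type) : Prop :=
  forall A : set X, ~ closed A -> forall p : X, (closure A `\` A) p ->
    exists F : K -> set X,
      [/\ forall a, F a `<=` A,
          closure (\bigcup_a F a) p &
          ~ (\bigcup_a closure (F a)) p].

(* Well defined when X is Hausdorff (see [set_tightnessP]); without T1 there
   may be no suitable cardinal. *)
Definition set_tightness : Type := least_infinite_card set_tightness_le.

End SetTightness.

(* [le] is the order of an initial ordinal: a well-order on [K] all of whose
   proper initial segments have cardinality smaller than [K].  As [le] is
   total, [~~ le b a] says that [a] is strictly below [b]. *)
Definition initial_well_order (K : Type) (le : rel K) : Prop :=
  well_order le /\ forall b, ~ ([set: K] #<= [set a | ~~ le b a]).

Section FreeSequences.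
Variable X : topologicalType.

Definition free_sequence (K : Type) (le : rel K) (x : K -> X) : Prop :=
  forall b, closure (x @` [set a | ~~ le b a]) `&`
            closure (x @` [set a | le b a]) = set0.

Definition free_sequences_le (K : Type) : Prop :=
  forall (S : Type) (le : rel S) (x : S -> X),
    initial_well_order le -> free_sequence le x -> [set: S] #<= [set: K].

(* max (omega, sup of the cardinalities of free sequences), as the least
   infinite upper bound of these cardinalities *)
Definition free_sequence_number : Type := least_infinite_card free_sequences_le.

End FreeSequences.

Section Lindelof.
Variable X : topologicalType.

Definition open_cover (U : set (set X)) : Prop :=
  (forall O, U O -> open O) /\ \bigcup_(O in U) O = [set: X].

Definition Lindelof_le (K : Type) : Prop :=
  forall U : set (set X), open_cover U ->
    exists V : set (set X),
      [/\ V `<=` U, \bigcup_(O in V) O = [set: X] & V #<= [set: K]].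

Definition Lindelof_degree : Type := least_infinite_card Lindelof_le.

End Lindelof.

Section LeastCardinals.

Lemma injective_card_le (T U : Type) (f : T -> U) :
  injective f -> [set: T] #<= [set: U].
Proof.
move=> finj; have [g] : $|{injfun [set: T] >-> [set: U]}|.
  by apply/injfunPex; exists f => // x y _ _ /finj.
exact: inj_card_le.
Qed.

Lemma card_le_injective (T U : Type) :
  [set: T] #<= [set: U] -> exists f : T -> U, injective f.
Proof.
move=> /card_leP[f]; exists (fun t => val (f (SigSub (mem_set (I : [set: T] t))))) => x y.
by move=> /val_inj/(@inj _ _ _ f); rewrite !inE => /(_ I I) [].
Qed.

(* A maximal set of choice functions that pairwise differ at every index is in
   bijection with some member of the family and injects into all of them. *)
Lemma least_card_family (I : Type) (T : I -> Type) : inhabited I ->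
  exists i, forall j, [set: T i] #<= [set: T j].
Proof.
move=> [i0].
pose P (S : set (forall i, T i)) :=
  forall f g, S f -> S g -> (exists i, f i = g i) -> f = g.
have [F FP Ftot|S [SP Smax]] := @Zorn_bigcup _ P.
  move=> f g [A FA Af] [B FB Bg] fg.
  have [AB|BA] := Ftot _ _ FA FB.
    by apply: (FP _ FB) => //; exact: AB.
  by apply: (FP _ FA) => //; exact: BA.
have [i surji] : exists i, forall t : T i, exists2 f, S f & f i = t.
  apply: contrapT => no.
  have ex i : exists t : T i, forall f, S f -> f i <> t.
    apply: contrapT => no2; apply: no; exists i => t.
    apply: contrapT => no3; apply: no2; exists t => f Sf ft.
    by apply: no3; exists f.
  pose h i := sval (cid (ex i)).
  have hP i f : S f -> f i <> h i by move=> Sf; exact: (svalP (cid (ex i))).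
  apply: (Smax (S `|` [set h])).
    split; first by move=> f; left.
    by move=> /(_ h (or_intror erefl)) Sh; exact: (hP i0 h Sh).
  move=> f g [Sf|->] [Sg|->] [i fg] //.
  - by apply: SP => //; exists i.
  - by case: (hP i f Sf).
  - by case: (hP i g Sg).
exists i => j.
pose c t := s2val (cid2 (surji t)).
have cP t : S (c t) /\ c t i = t by rewrite /c; case: cid2.
apply: (@injective_card_le _ _ (fun t => c t j)) => s t cst.
have [[Ss <-] [St <-]] := (cP s, cP t).
by congr (_ i); apply: SP => //; exists j.
Qed.

Lemma card_le_total (T U : Type) :
  [set: T] #<= [set: U] \/ [set: U] #<= [set: T].
Proof.
have [[] leTU] := least_card_family (fun b : bool => if b then T else U)
  (inhabits true).
- by left; exact: (leTU false).
- by right; exact: (leTU true).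
Qed.

Lemma least_infinite_card_exists (P : Type -> Prop) :
  (exists K, infinite_set [set: K] /\ P K) ->
  exists K, is_least_infinite_card P K.
Proof.
move=> [K0 [K0inf PK0]].
pose Q K := infinite_set [set: K] /\ P K.
pose I := {S : set K0 | exists K, Q K /\ [set: K] #= S}.
have i0 : I by exists setT; exists K0.
have [i imin] := least_card_family (fun i : I => projT1 i) (inhabits i0).
have [K [[Kinf PK] Ki]] := projT2 i.
exists K; split => // K' K'inf PK'.
have iK' : projT1 i #<= [set: K'].
  have [|/card_le_injective[f finj]] := card_le_total K0 K'.
    apply: card_le_trans; exact: card_leT.
  have K'f : [set: K'] #= range f.
    rewrite card_eq_sym; apply: inj_card_eq; exact: in2W.
  have j : {j : I | projT1 j = range f}.
    by unshelve eexists; [exists (range f); exists K'|].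
  rewrite (card_le_eqr K'f) -(projT2 j).
  by have := imin (projT1 j); rewrite (card_le_eql (card_setT _))
    (card_le_eqr (card_setT _)).
by rewrite (card_le_eql Ki).
Qed.

Lemma least_infinite_cardP (P : Type -> Prop) :
  (exists K, infinite_set [set: K] /\ P K) ->
  is_least_infinite_card P (least_infinite_card P).
Proof.
move=> /least_infinite_card_exists ex; rewrite /least_infinite_card.
by case: pselect => // ex'; exact: (svalP (cid ex')).
Qed.

End LeastCardinals.

Section CardinalFunctionsExist.
Variable X : topologicalType.

Let infinite_sum : infinite_set [set: X + nat].
Proof. by apply/infiniteP/(@injective_card_le _ _ inr) => m n []. Qed.

Let card_le_sum : [set: X] #<= [set: X + nat].
Proof. by apply: (@injective_card_le _ _ inl) => x y []. Qed.

Lemma set_tightnessP : hausdorff_space X ->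
  is_least_infinite_card (@set_tightness_le X) (set_tightness X).
Proof.
move=> hX; apply: least_infinite_cardP; exists (X + nat)%type; split => //.
move=> A _ p [clAp nAp].
exists (fun a => if a is inl x then [set x] `&` A else set0); split.
- by case=> [x|n] y //= [].
- apply: closureS clAp => x Ax; exists (inl x) => //; split => //.
- move=> [[x|n] _ /=]; last by rewrite closure0.
  move=> clxp; have clx : closed [set x].
    exact/accessible_closed_set1/hausdorff_accessible.
  have px : p = x.
    suff : closure [set x] p by rewrite -((closure_id _).1 clx).
    by apply: closureS clxp => y [].
  have [|y [[-> Ax] _]] := clxp setT; first exact: filterT.
  by apply: nAp; rewrite px.
Qed.

Lemma free_sequence_numberP :
  is_least_infinite_card (@free_sequences_le X) (free_sequence_number X).
Proof.
apply: least_infinite_cardP; exists (X + nat)%type; split => //.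
move=> S le x [wo _] free; apply: card_le_trans card_le_sum.
have refl a : le a a.
  have [|z [[/asboolP zE lz] _]] := wo [pred z | `[< z = a >]].
    by exists a; apply/asboolP.
  by rewrite -{1}zE; apply: lz; apply/asboolP.
have anti a b : le a b -> le b a -> a = b.
  move=> ab ba; have [|z [_ uz]] := wo [pred z | `[< z = a \/ z = b >]].
    by exists a; apply/asboolP; left.
  rewrite -(uz a) ?(uz b) //; split.
  - by apply/asboolP; right.
  - by move=> c /asboolP[] ->.
  - by apply/asboolP; left.
  - by move=> c /asboolP[] ->.
have disj a b : ~~ le b a -> x a <> x b.
  move=> ba xab; suff : set0 (x a) by [].
  rewrite -(free b); split; apply: subset_closure => /=; first by exists a.
  by exists b.
apply: (@injective_card_le _ _ x) => a b xab; apply: anti.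
- by apply: contrapT => /negP/disj; apply.
- by apply: contrapT => /negP/disj; apply.
Qed.

Lemma Lindelof_degreeP :
  is_least_infinite_card (@Lindelof_le X) (Lindelof_degree X).
Proof.
apply: least_infinite_cardP; exists (X + nat)%type; split => //.
move=> U [_ Ucov].
have ex x : exists O, U O /\ O x.
  by have : [set: X] x by []; rewrite -Ucov => -[O]; exists O.
have [f fP] := choice ex.
exists (range f); split.
- by move=> _ [x _ <-]; have [] := fP x.
- rewrite -subTset => x _; exists (f x); first by exists x.
  by have [] := fP x.
- exact: card_le_trans (card_image_le _ _) card_le_sum.
Qed.

End CardinalFunctionsExist.

(* Main.v *)
Require Import Defs.
From mathcomp Require Import all_boot.
From mathcomp Require Import boolp classical_sets functions cardinality wochoice.
From mathcomp Require Import topology.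

(** Let [K] be the product of the two cardinals on the right, and suppose that
    [K] subsets never witness the set-tightness of a set [A] at a point [p] of
    its closure outside [A].  Call a subset of [A] small if [p] is not in its
    closure.  The assumption says exactly that a union of at most [K] small
    sets is small ([not_closure_bigcup]), while [A] itself is not small.

    Points of [A] are small, so every [B] included in [A] of cardinality at
    most [K] is small.  By the Hausdorff property each point of [closure B] has
    an open neighborhood whose closure misses [p], and at most [K] of them
    cover [closure B] ([Lindelof_separation]).  Their union [U B] is an open
    set that contains [closure B] and still has a small trace on [A].

    Along a well-order of type the successor cardinal of [K], choose [x a] in
    [A] outside the sets [U {x c | c < b}] for all [b <= a].  This is possible
    because these are at most [K] sets with small traces on [A].  For each [b]
    the open set [U {x c | c < b}] contains the closure of the terms before [b]
    and no term from [b] on, so that [x] is a free sequence.  It is longer than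
    [K], which is impossible. *)

Local Open Scope classical_set_scope.
Local Open Scope card_scope.

Set Implicit Arguments.
Unset Strict Implicit.

(** * Well-orders and recursion *)

Section WellOrders.
Variables (S : Type) (le : rel S).
Hypothesis wo : well_order le.

Lemma well_order_least (P : set S) (s : S) :
  P s -> exists2 z, P z & forall c, P c -> le z c.
Proof.
move=> Ps; have [|z [[/asboolP Pz lz] _]] := wo (A := [pred z | `[< P z >]]).
  by exists s; apply/asboolP.
by exists z => // c Pc; apply: lz; apply/asboolP.
Qed.

Lemma well_order_total (a b : S) : le a b \/ le b a.
Proof.
have [|z [] -> lz] := @well_order_least [set z | z = a \/ z = b] a.
- by left.
- by left; apply: lz; right.
- by right; apply: lz; left.
Qed.

Lemma well_order_anti (a b : S) : le a b -> le b a -> a = b.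
Proof.
have refl c : le c c by case: (well_order_total c c).
move=> ab ba; have [|z [_ uz]] := wo (A := [pred z | `[< z = a \/ z = b >]]).
  by exists a; apply/asboolP; left.
rewrite -(uz a) ?(uz b) //; split.
- by apply/asboolP; right.
- by move=> c /asboolP[] ->.
- by apply/asboolP; left.
- by move=> c /asboolP[] ->.
Qed.

Lemma well_order_trans (a b c : S) : le a b -> le b c -> le a c.
Proof.
move=> ab bc.
have [|z zP lz] := @well_order_least [set z | [\/ z = a, z = b | z = c]] a.
  by constructor 1.
have [za zb zc] : [/\ le z a, le z b & le z c].
  by split; apply: lz; [constructor 1|constructor 2|constructor 3].
case: zP => zE; subst z => //.
- by rewrite (well_order_anti ab za).
- by rewrite -(well_order_anti bc zb).
Qed.

Lemma well_order_wf : well_founded (fun a b => ~~ le b a).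
Proof.
move=> a; apply: contrapT => na.
have [z nz lz] := well_order_least (P := [set z | ~ Acc _ z]) na.
apply: nz; constructor => b /negP zb; apply: contrapT => nb.
exact/zb/lz.
Qed.

(** The step [g] takes a total function, not one defined on the terms before
    [a] only: the later values are overwritten by the default [t0], which
    avoids dependent types in the applications. *)
Lemma well_order_recursion (T : Type) (t0 : T) (g : S -> (S -> T) -> T) :
  exists f : S -> T,
    forall a, f a = g a (fun b => if le a b then t0 else f b).
Proof.
pose step a (rec : forall b, ~~ le a b -> T) :=
  g a (fun b => if pselect (~~ le a b) is left ab then rec b ab else t0).
exists (Fix well_order_wf (fun=> T) step) => a.
rewrite Fix_eq => [|{}a f h fh]; congr g; apply/funext => b.
- by case: pselect => [/negbTE -> //|]; case: (le a b).
- by case: pselect => // ab; rewrite fh.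
Qed.

Lemma well_order_pullback (R : Type) (f : R -> S) :
  injective f -> well_order (fun a b => le (f a) (f b)).
Proof.
move=> finj A [s As].
have [|_ [z Az <-] lz] := @well_order_least (f @` [set` A]) (f s).
  by exists s.
have zmin c : c \in A -> le (f z) (f c) by move=> Ac; apply: lz; exists c.
exists z; split=> [|c [Ac lc]]; first by split => // c /zmin.
by apply/finj/well_order_anti; [exact: zmin|exact: lc].
Qed.

End WellOrders.

(** * Successor cardinals *)

Lemma powerset_card_nle (K : Type) : ~ ([set: set K] #<= [set: K]).
Proof.
move=> /card_le_injective[f finj].
pose D := [set k | exists2 A, f A = k & ~ A k].
have nD : ~ D (f D) by move=> DfD; case: (DfD) => A /finj -> /(_ DfD).
by apply: (nD); exists D.
Qed.

(** In a well-order of the powerset of [K], keep the elements with at most [K]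
    predecessors.  They form an initial segment, so if there were at most [K] of
    them, then the first element left out would have at most [K] predecessors
    and would have been kept.  When nothing is left out, the powerset itself is
    too large. *)
Lemma initial_well_order_successor (K : Type) :
  exists (S : Type) (le : rel S),
    [/\ initial_well_order le, ~ ([set: S] #<= [set: K]) &
        forall b, [set a | ~~ le b a] #<= [set: K]].
Proof.
have [le wo] := well_ordering_principle (set K : eqType).
pose seg b := [set a | ~~ le b a].
pose D := [set b | seg b #<= [set: K]].
pose S := {b : set K | D b}.
pose leS : rel S := fun a b => le (sval a) (sval b).
have vinj : injective (fun b : S => sval b).
  by move=> [a Da] [b Db] /= ab; subst b; congr exist; exact: Prop_irrelevance.
have segS (b : S) : [set a | ~~ leS b a] #<= [set: K].
  apply: card_le_trans (svalP b).
  apply: card_le_trans (_ : _ #<= (fun a : S => sval a) @` [set a | ~~ leS b a]) _.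
    rewrite (card_le_eqr (inj_card_eq _)) ?card_lexx//.
    by move=> x y _ _; exact: vinj.
  by apply: subset_card_le => _ [a /= ab <-].
have nS : ~ ([set: S] #<= [set: K]).
  move=> SK; have DK : D #<= [set: K].
    apply: card_le_trans SK; apply: card_le_trans (card_image_le (fun b : S => sval b) _).
    by apply: subset_card_le => b Db; exists (exist _ b Db).
  have [b0 nDb0] : exists b, ~ D b.
    apply: contrapT => allD; apply: (@powerset_card_nle K).
    apply: card_le_trans DK; apply: subset_card_le => b _.
    by apply: contrapT => nDb; apply: allD; exists b.
  have [b nDb bmin] := well_order_least wo (P := ~` D) nDb0.
  apply: nDb; apply: card_le_trans DK; apply: subset_card_le => a /negP ba.
  by apply: contrapT => /bmin.
exists S, leS; split => //; split; first exact: well_order_pullback.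
by move=> b Sb; apply: nS; exact: card_le_trans Sb (segS b).
Qed.

(** * From set-tightness to free sequences *)

(** The neighborhoods that separate the points of [C] from [p], together with
    the complement of [C], cover the space.  A subcover still covers [C] once
    the complement of [C] is removed. *)
Lemma Lindelof_separation (X : topologicalType) (K : Type) (C : set X) (p : X) :
  hausdorff_space X -> @Lindelof_le X K -> closed C -> ~ C p ->
  exists V : set (set X),
    [/\ forall O, V O -> open O /\ ~ closure O p,
        C `<=` \bigcup_(O in V) O & V #<= [set: K]].
Proof.
move=> hX LK clC nCp.
pose W := [set O : set X | open O /\ ~ closure O p].
have [|V [VW Vcov VK]] := LK (W `|` [set ~` C]).
  split; first by move=> O [[]|->] //; rewrite openC.
  rewrite -subTset => x _; have [Cx|nCx] := pselect (C x); last first.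
    by exists (~` C) => //; right.
  have xp : x != p by apply/eqP => xp; apply: nCp; rewrite -xp.
  move: hX; rewrite open_hausdorff => /(_ _ _ xp)[[O P] /= [/set_mem Ox /set_mem Pp]].
  move=> [opO opP /eqP OP0]; exists O => //; left; split => //.
  move=> /(_ P)[]; first exact: open_nbhs_nbhs.
  by rewrite OP0 => y.
exists (V `&` W); split.
- by move=> O [].
- move=> x Cx; have : [set: X] x by [].
  rewrite -Vcov => -[O VO Ox]; exists O => //; split => //.
  by case: (VW _ VO) => // OC; move: Ox; rewrite OC.
- by apply: card_le_trans VK; apply: subset_card_le => O [].
Qed.

(** The family excluded by the hypothesis is indexed by all of [K].  A family
    over [D] is transported along an injection of [D] into [K] and completed by
    empty sets, whose closure does not contain [p]. *)
Lemma not_closure_bigcup (X : topologicalType) (K : Type) (A : set X) (p : X) :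
  ~ (exists F : K -> set X,
      [/\ forall a, F a `<=` A,
          closure (\bigcup_a F a) p &
          ~ (\bigcup_a closure (F a)) p]) ->
  forall (J : Type) (D : set J) (G : J -> set X), D #<= [set: K] ->
    (forall j, D j -> ~ closure (G j `&` A) p) ->
    ~ closure ((\bigcup_(j in D) G j) `&` A) p.
Proof.
move=> noF J D G; rewrite -(card_le_eql (card_setT D)).
move=> /card_le_injective[f finj] Gp clp; apply: noF.
exists (fun k => [set x | exists j : D, [/\ f j = k, G (val j) x & A x]]); split.
- by move=> k x [j []].
- apply: closureS clp => x [[j Dj Gx] Ax].
  by exists (f (SigSub (mem_set Dj))) => //; exists (SigSub (mem_set Dj)).
- move=> [k _ clk].
  have [y [[j [fj _ _]] _]] := clk setT filterT.
  apply: (Gp (val j)); first exact/set_mem/(valP j).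
  apply: closureS clk => x [i [fi Gx Ax]].
  by split => //; rewrite (finj j i) // fj fi.
Qed.

(** The free sequence is built here: [U B] is an open set around the closure of
    the trace of [B] on [A], and the choice [pick] avoids the sets [U]
    associated with all initial segments up to and including the current
    one. *)
Lemma set_tightness_le_Lindelof_free (X : topologicalType) (K : Type) :
  hausdorff_space X -> @Lindelof_le X K -> @free_sequences_le X K ->
  @set_tightness_le X K.
Proof.
move=> hX LK FK A _ p [clAp nAp]; apply: contrapT => noF.
have bigcupP := @not_closure_bigcup X K A p noF.
have pointP x : ~ closure ([set x] `&` A) p.
  move=> clxp; have [y [[yx Ay] _]] := clxp setT filterT.
  have clx : closed [set x].
    exact/accessible_closed_set1/hausdorff_accessible.
  have : closure [set x] p by apply: closureS clxp => z [].
  by rewrite -((closure_id _).1 clx) => px; apply: nAp; rewrite px -yx.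
(* Taking the trace of B on A lets the step of the recursion be defined for
   every function, even one with values outside A. *)
have [U UP] : exists U : set X -> set X, forall B, B #<= [set: K] ->
    [/\ open (U B), closure (B `&` A) `<=` U B & ~ closure (U B `&` A) p].
  suff /choice[U UP] : forall B, exists U, B #<= [set: K] ->
    [/\ open U, closure (B `&` A) `<=` U & ~ closure (U `&` A) p] by exists U.
  move=> B.
  have [BK|nBK] := pselect (B #<= [set: K]); last by exists set0.
  have clBp : ~ closure (B `&` A) p.
    have -> : B = \bigcup_(x in B) [set x] by rewrite bigcup_imset1 image_id.
    exact: bigcupP.
  have [V [Vopen BV VK]] := Lindelof_separation hX LK (@closed_closure _ _) clBp.
  exists (\bigcup_(O in V) O) => _; split => //.
  - by apply: bigcup_open => O /Vopen[].
  - apply: bigcupP => // O /Vopen[_ nO] clO; apply: nO.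
    by apply: closureS clO => x [].
have [S [le [[wo init] nSK segK]]] := initial_well_order_successor K.
pose seg b := [set a | ~~ le b a].
have imK (f : S -> X) b : f @` seg b #<= [set: K].
  exact: card_le_trans (card_image_le _ _) (segK b).
have [pick pickP] : exists g : S * (S -> X) -> X, forall af, A (g af) /\
    forall b, le b af.1 -> ~ U (af.2 @` seg b) (g af).
  suff /choice[g gP] : forall af : S * (S -> X), exists y, A y /\
    forall b, le b af.1 -> ~ U (af.2 @` seg b) y by exists g.
  move=> [a f] /=; apply: contrapT => noy.
  pose W := \bigcup_(b in seg a) U (f @` seg b).
  have nW : ~ closure (W `&` A) p.
    by apply: bigcupP => [|b _]; [exact: segK|have [] := UP _ (imK f b)].
  have [_ _ nUa] := UP _ (imK f a).
  (* The segment of a itself is treated apart: adding a to the index set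
     would require an extra cardinality computation. *)
  suff AW : A `<=` (W `&` A) `|` (U (f @` seg a) `&` A).
    by have := closureS AW clAp; rewrite closureU => -[].
  move=> y Ay; apply: contrapT => nWy; apply: noy; exists y; split => // b ba Uy.
  apply: nWy; have [ab|nab] := boolP (le a b).
    by right; rewrite -(well_order_anti wo ba ab).
  by left; split => //; exists b.
have [x xE] := well_order_recursion wo p (fun a f => pick (a, f)).
have xP a : A (x a) /\ forall b, le b a -> ~ U (x @` seg b) (x a).
  rewrite xE; have [Ag Ug] := pickP (a, fun b => if le a b then p else x b).
  split => // b ba; have := Ug b ba => /=.
  (* Below a, the truncated function of the recursion agrees with x. *)
  have eqx c : seg b c -> (if le a c then p else x c) = x c.
    move=> /= bc; case: ifP => // ac; case/negP: bc.
    exact: (well_order_trans wo ba ac).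
  by rewrite (eq_imagel eqx).
apply: nSK; apply: (FK S le x) => // b; apply/seteqP; split => // y [clsy cly].
have [opU clU _] := UP _ (imK x b).
have Uy : U (x @` seg b) y.
  by apply: clU; apply: closureS clsy => _ [a sa <-]; split; [exists a|case: (xP a)].
have [|_ [[a /= ba <-] Ua]] := cly (U (x @` seg b)); first exact: open_nbhs_nbhs.
by case: (xP a) => _ /(_ b ba).
Qed.

Theorem theorem6 (X : topologicalType) (hX : hausdorff_space X) :
  [set: set_tightness X] #<=
  [set: (free_sequence_number X * Lindelof_degree X)%type].
Proof.
have [Finf Fle _] := free_sequence_numberP X.
have [Linf Lle _] := Lindelof_degreeP X.
have [[f0 _] [l0 _]] := (infinite_setN0 Finf, infinite_setN0 Linf).
have FK : [set: free_sequence_number X] #<=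
    [set: (free_sequence_number X * Lindelof_degree X)%type].
  by apply: (@injective_card_le _ _ (fun f => (f, l0))) => f g [].
have LK : [set: Lindelof_degree X] #<=
    [set: (free_sequence_number X * Lindelof_degree X)%type].
  by apply: (@injective_card_le _ _ (fun l => (f0, l))) => l m [].
have [_ _] := set_tightnessP hX; apply.
- by apply/infiniteP/card_le_trans/FK/infiniteP.
- apply: set_tightness_le_Lindelof_free => //.
  + move=> O /Lle[V [VO Vcov VL]]; exists V; split => //.
    exact: card_le_trans VL LK.
  + by move=> S le x wo /(Fle _ _ _ wo) SF; exact: card_le_trans SF FK.
Qed.
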